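(* For $a,b,c,d\in\mathbb{Q}$ let $f_{a,b,c,d}:\mathbb{P}^2_{\mathbb{Q}}\to\mathbb{P}^2_{\mathbb{Q}}$ be the morphism extending the affine map $f_{a,b,c,d}(x,y)=(x^2+ax+by,\ y^2+cx+dy)$, i.e. $[x:y:z]\mapsto[x^2+axz+byz:y^2+cxz+dyz:z^2]$. Then $f_{a,b,c,d}$ is post-critically finite if and only if \[(a,b,c,d)\in\{(0,0,0,0),(0,0,0,-2),(-2,0,0,-2),(0,0,-1,0),(0,0,-2,0),(0,-2,-2,0)\}\] or $f_{a,b,c,d}$ is conjugate to one of the maps $f_{a',b',c',d'}$ with $(a',b',c',d')$ in this list by a change of coordinates.
   Context: A morphism $f:\mathbb{P}^2\to\mathbb{P}^2$ is post-critically finite if the forward orbit under $f$ of its critical (ramification) locus is supported on a finite union of curves. *)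

(* Defs.v *)
From HB Require Import structures.
From mathcomp Require Import all_boot all_order all_algebra all_field.
From mathcomp Require Import mpoly.
Set Implicit Arguments. Unset Strict Implicit. Unset Printing Implicit Defensive.
Import Order.TTheory GRing.Theory Num.Theory.
Local Open Scope ring_scope.

(* Homogeneous coordinates [x:y:z] of P^2(Qbar): nonzero triples. *)
Definition pt := 'I_3 -> algC.
Definition nonzero_pt (v : pt) : Prop := exists i, v i != 0.
Definition proj_eq (u w : pt) : Prop :=
  exists l : algC, l != 0 /\ forall i, u i = l * w i.

(* An endomorphism of P^2 given by a triple of homogeneous polynomials. *)
Definition polymap := 'I_3 -> {mpoly algC[3]}.
Definition apply_map (F : polymap) (v : pt) : pt := fun i => (F i).@[v].

(* Critical (ramification) locus: zero locus of the Jacobian determinant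
   of the homogeneous lift. *)
Definition jacobian (F : polymap) : 'M[{mpoly algC[3]}]_3 :=
  \matrix_(i, j) mderiv j (F i).
Definition critical_pt (F : polymap) (v : pt) : Prop :=
  nonzero_pt v /\ (\det (jacobian F)).@[v] = 0.

(* Post-critically finite: the forward orbit  U_{n>=1} F^n(Crit F)  is
   contained in (hence supported on) the zero locus of a nonzero homogeneous
   polynomial, i.e. in a finite union of curves. *)
Definition pcf (F : polymap) : Prop :=
  exists (d : nat) (G : {mpoly algC[3]}),
    G != 0 /\ G \is d.-homog /\
    forall v, critical_pt F v ->
      forall n : nat, (0 < n)%N -> G.@[iter n (apply_map F) v] = 0.

Definition fabcd (a b c d : rat) : polymap := fun i =>
  let x := 'X_(0 : 'I_3) in let y := 'X_(1 : 'I_3) in let z := 'X_(2 : 'I_3) in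
  if i == 0 :> 'I_3 then x ^+ 2 + (ratr a)%:MP * x * z + (ratr b)%:MP * y * z
  else if i == 1 :> 'I_3 then y ^+ 2 + (ratr c)%:MP * x * z + (ratr d)%:MP * y * z
  else z ^+ 2.

Definition lin_act (M : 'M[algC]_3) (v : pt) : pt := fun i => \sum_j M i j * v j.

Definition conjugate (F G : polymap) : Prop :=
  exists M : 'M[algC]_3, M \in unitmx /\
    forall v, nonzero_pt v ->
      proj_eq (apply_map F (lin_act M v)) (lin_act M (apply_map G v)).

Definition pcf_list : seq (rat * rat * rat * rat) :=
  [:: (0, 0, 0, 0); (0, 0, 0, -2); (-2, 0, 0, -2);
      (0, 0, -1, 0); (0, 0, -2, 0); (0, -2, -2, 0)].

(* Main.v *)
Require Import Defs.
From HB Require Import structures.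
From mathcomp Require Import all_boot all_order all_algebra all_field.
From mathcomp Require Import mpoly.
From mathcomp Require Import ring lra zify.
Set Implicit Arguments. Unset Strict Implicit. Unset Printing Implicit Defensive.
Import Order.TTheory GRing.Theory Num.Theory.
Local Open Scope ring_scope.

(* The critical locus consists of the line at infinity and the conic
   (2x + a)(2y + d) = bc, which has one branch at each of the points [1:0:0] and
   [0:1:0].  If the forward orbit of the conic lies on finitely many curves, then
   the Puiseux expansions of the images of the branch at [1:0:0] form a finite
   set.  After n iterations the leading term of the expansion is
   y = c_n x^(1/2), where c_n runs through the critical orbit of z^2 + c; hence
   z^2 + c is a post-critically finite quadratic polynomial over Q and
   c is 0, -1 or -2.  The subleading terms must eventually vanish too, since their
   exponents would otherwise take infinitely many values; for c = -1 and c = -2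
   this gives equations between a, b and d.  If c = 0 then y^2 + dy is itself
   post-critically finite.  The same constraints at [0:1:0] leave finitely many
   maps, all of which become one of the six listed maps after translating a
   rational fixed point to the origin and possibly exchanging x and y.
   Conversely, each of the six maps has an explicit invariant curve containing
   the image of its critical locus. *)

(** * Leading forms along a branch at infinity *)

Definition pt3 (K : Type) (x y z : K) : 'I_3 -> K :=
  fun i => if i == 0 :> 'I_3 then x else if i == 1 :> 'I_3 then y else z.

Lemma poly_eq0_horner (K : numFieldType) (p : {poly K}) :
  (forall x, p.[x] = 0) -> p = 0.
Proof.
move=> p0; apply: (@roots_geq_poly_eq0 _ p [seq i%:R | i <- iota 0 (size p)]).
- by apply/allP => x _; rewrite /root p0.
- by rewrite map_inj_uniq ?iota_uniq // => i j /eqP; rewrite eqr_nat => /eqP.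
- by rewrite size_map size_iota.
Qed.

Lemma coprime_Xn (K : fieldType) n (p : {poly K}) :
  p.[0] != 0 -> coprimep 'X^n p.
Proof.
move=> p0; apply: coprimep_expl; rewrite coprimep_sym.
by rewrite -[X in coprimep _ X]subr0 -polyC0 coprimep_XsubC.
Qed.

(** Hensel lifting, one coefficient at a time: [r] is a truncation of the power series [A^(-1/e)],
    and each step divides by [e], which is invertible in characteristic 0. *)
Lemma inverse_root_modX (K : numFieldType) (e n : nat) (A : {poly K}) :
  (0 < e)%N -> A.[0] = 1 ->
  exists2 r : {poly K}, r.[0] = 1 & 'X^n %| r ^+ e * A - 1.
Proof.
move=> e0 A0; elim: n => [|n [r r0 /dvdpP[q Hq]]].
  by exists 1; rewrite ?hornerE // expr0 dvd1p.
case: n Hq => [|n] Hq.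
  exists 1; first by rewrite hornerE.
  rewrite expr1n mul1r expr1 -['X]subr0 -polyC0 dvdp_XsubCl /root.
  by rewrite !hornerE A0 subrr.
(* Adding [c X^(n+1)] to [r] changes the next coefficient of [r^e A] by [e c]; this [c] cancels the
   error. *)
pose c : K := - q.[0] / e%:R.
pose s := r + c *: 'X^(n.+1).
have s0 : s.[0] = 1 by rewrite !hornerE r0 expr0n mulr0 addr0.
exists s => //.
pose S := \sum_(i < e) s ^+ (e.-1 - i) * r ^+ i.
have S0 : S.[0] = e%:R.
  rewrite horner_sum (eq_bigr (fun=> 1)); last first.
    by move=> i _; rewrite hornerM !horner_exp s0 r0 !expr1n mulr1.
  by rewrite sumr_const card_ord.
have -> : s ^+ e * A - 1 = (q + c *: (S * A)) * 'X^(n.+1).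
  have -> : s ^+ e = r ^+ e + (s ^+ e - r ^+ e) by ring.
  rewrite subrXX -/S mulrDl addrAC Hq {1}/s addrAC subrr add0r.
  by rewrite mulrDl -!scalerAl; congr (_ + _ *: _); ring.
rewrite ['X^(n.+2)]exprS dvdp_mul2r; last by rewrite expf_neq0 // polyX_eq0.
rewrite -['X]subr0 -polyC0 dvdp_XsubCl /root.
rewrite hornerD hornerZ hornerM S0 A0 /c mulr1 mulfVK ?subrr //.
by rewrite pnatr_eq0 -lt0n.
Qed.

Section WeightedExpansion.
Variables (K : numFieldType) (e : nat) (D : nat) (G : {mpoly K[3]}).
Hypotheses (e0 : (0 < e)%N) (G0 : G != 0) (hG : G \is D.-homog).

(* The expansion of [G(1, s q, s^e)] in powers of [s], with coefficients in [q]. *)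
Definition wexp : {poly {poly K}} :=
  \sum_(m <- msupp G) (G@_m *: 'X^(m 1%R))%:P
     * 'X^(m 1%R + e * m 2%R).

Lemma mdeg3 (m : 'X_{1..3}) :
  mdeg m = (m 0%R + (m 1%R + m 2%R))%N.
Proof.
rewrite mdegE !big_ord_recl big_ord0 addn0.
by congr (_ + (_ + _))%N; congr (fun_of_multinom m); apply/val_inj.
Qed.

Lemma mdeg_supp m : m \in msupp G ->
  D = (m 0%R + (m 1%R + m 2%R))%N.
Proof. by move=> mG; rewrite -mdeg3; move/dhomogP: hG => ->. Qed.

(** No two monomials of [G] can cancel: the power of [q] gives the exponent of the second variable,
    the power of [s] then gives that of the third, and homogeneity gives that of the first. *)
Lemma wexp_neq0 : wexp != 0.
Proof.
have [m0 m0G] : exists m, m \in msupp G.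
  case E: (msupp G) => [|m s]; last by exists m; rewrite mem_head.
  by move/eqP: E; rewrite msupp_eq0 (negPf G0).
apply/eqP => /(congr1 (fun p : {poly {poly K}} =>
  p`_(m0 1%R + e * m0 2%R)`_(m0 1%R))).
rewrite !coef0 /wexp !coef_sum (bigD1_seq m0) ?msupp_uniq //= big1_seq => [|m].
  rewrite addr0 coefCM coefXn eqxx mulr1 coefZ coefXn eqxx mulr1 => /eqP.
  by rewrite mcoeff_eq0 m0G.
case/andP=> neq mG; rewrite coefCM coefXn.
case: eqP => [E|_]; last by rewrite mulr0 coef0.
rewrite mulr1 coefZ coefXn; case: eqP => [E1|_]; last by rewrite mulr0.
case/eqP: neq; have := mdeg_supp mG; rewrite (mdeg_supp m0G) => E0.
have E2 : m0 2%R = m 2%R.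
  by move: E; rewrite E1 => /addnI/eqP; rewrite eqn_pmul2l // => /eqP.
apply/mnmP => i; case: (altP (i =P 0)) => [->|i0]; first by lia.
case: (altP (i =P 1)) => [-> //|i1].
suff -> : i = 2 by [].
by case: i i0 i1 => [[|[|[|]]]] //= *; apply/val_inj.
Qed.

(* The lowest-order part in the small variable [s] of [G(1, s q, s^e)] is a
   nonzero polynomial in [q]; dividing by [r^e] normalises the first
   coordinate to 1 up to high order. *)
Lemma weighted_leading_form : exists2 h : {poly K}, h != 0 &
  forall (A B : {poly K}) (N : nat), A.[0] = 1 ->
    (forall t, G.@[pt3 A.[t] (t ^+ N * B.[t]) (t ^+ (e * N))] = 0) ->
    exists r : {poly K}, [/\ r.[0] = 1, 'X^N %| r ^+ e * A - 1
      & 'X^N %| h \Po (r ^+ e.-1 * B)].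
Proof.
have [mu [Q]] := multiplicity_XsubC wexp 0.
rewrite wexp_neq0 /= polyC0 subr0 => Q0 EQ.
exists Q.[0] => // A B N A0 GAB.
(* The expansion starts at order [mu] in [s], that is [N mu] in [X], so the precision [N (mu + 1)]
   leaves [N] orders after division. *)
have [r r0 Hr] := inverse_root_modX (N * mu.+1) e0 A0.
exists r; split => //.
  by apply: dvdp_trans Hr; apply: dvdp_exp2l; rewrite leq_pmulr.
(* Scaling the point by [r^e] gives [[r^e A : s b : s^e]], so [b] is the value to substitute for
   [q]. *)
set b := r ^+ e.-1 * B; pose s := r * 'X^N.
pose ev (P : {poly {poly K}}) := (map_poly (comp_poly b) P).[s].
have evM P1 P2 : ev (P1 * P2) = ev P1 * ev P2 by rewrite /ev rmorphM hornerM.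
have evX : ev 'X = s by rewrite /ev map_polyX hornerX.
have evC c : ev c%:P = c \Po b by rewrite /ev map_polyC hornerC.
have evXn n : ev 'X^n = s ^+ n by rewrite /ev map_polyXn hornerXn.
pose t m := G@_m *: (b ^+ m 1%R * s ^+ (m 1%R + e * m 2%R)).
have evP : ev wexp = \sum_(m <- msupp G) t m.
  rewrite /ev rmorph_sum horner_sum; apply: eq_bigr => m _.
  rewrite -/(ev _) evM evC evXn comp_polyZ -scalerAl; congr (_ *: (_ * _)).
  by rewrite rmorphXn /= comp_polyX.
have Z : \sum_(m <- msupp G) (r ^+ e * A) ^+ m 0%R * t m = 0.
  have -> : \sum_(m <- msupp G) (r ^+ e * A) ^+ m 0%R * t m =
    r ^+ (e * D) * \sum_(m <- msupp G) G@_m *: (A ^+ m 0%R *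
       (('X^N * B) ^+ m 1%R * 'X^(e * N) ^+ m 2%R)).
    rewrite big_distrr; apply: eq_big_seq => m mG /=.
    rewrite (mdeg_supp mG) /t /b /s -!scalerAr; congr (_ *: _).
    rewrite !exprMn -!exprM.
    move: (m 0%R) (m 1%R) (m 2%R) => i j k.
    have -> : (N * (j + e * k) = N * j + e * N * k)%N by ring.
    have -> : (e * (i + (j + k)) = e * i + (e.-1 * j + (j + e * k)))%N.
      by case: e e0 => // e' _; rewrite /=; ring.
    by rewrite !exprD; ring.
  rewrite [X in _ * X](_ : _ = 0) ?mulr0 //.
  apply: poly_eq0_horner => x; rewrite -[RHS](GAB x) mevalE horner_sum.
  apply: eq_bigr => m _; rewrite hornerZ !hornerM !horner_exp hornerM !horner_exp hornerX.
  congr (_ * _); rewrite !big_ord_recl big_ord0 mulr1 /pt3 /=.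
  by congr (_ ^+ _ * (_ ^+ _ * _ ^+ _)); congr (fun_of_multinom m);
     apply/val_inj.
(* By [Z] the sum vanishes when the first coordinate is [r^e A]; replacing it by 1 changes each term
   by a multiple of [r^e A - 1]. *)
have dvP : 'X^(N * mu.+1) %| ev wexp.
  rewrite evP -[X in _ %| X]subr0 -[X in _ - X]Z -sumrB.
  apply: (big_ind (fun p => 'X^(N * mu.+1) %| p)) => [|p q|m _]; first exact: dvdp0.
    exact: dvdp_add.
  rewrite -{1}[t m]mul1r -mulrBl; apply: dvdp_mulr.
  by rewrite -opprB dvdpNr subrX1; apply: dvdp_mulr.
have E : ev wexp = (ev Q * r ^+ mu) * 'X^(N * mu).
  by rewrite EQ evM evXn /s exprMn -exprM mulrA.
move: dvP; rewrite E mulnS exprD dvdp_mul2r ?expf_neq0 ?polyX_eq0 //.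
rewrite Gauss_dvdpl; last first.
  by apply: coprime_Xn; rewrite horner_exp r0 expr1n oner_eq0.
have /factor_theorem[Q2 EQ2] : root (Q - Q.[0]%:P) 0.
  by rewrite /root !hornerE subrr.
have -> : Q = Q2 * 'X + Q.[0]%:P.
  by apply/eqP; rewrite -subr_eq EQ2 polyC0 subr0.
rewrite {1}/ev rmorphD hornerD -!/(ev _) evM evX evC /s.
rewrite dvdp_addr //; last by rewrite mulrA dvdp_mull.
by rewrite !hornerE.
Qed.

End WeightedExpansion.

(** * Critical points *)

Lemma forall_I3 (P : 'I_3 -> Prop) : P 0 -> P 1 -> P 2 -> forall i, P i.
Proof.
move=> P0 P1 P2 i.
case: (altP (i =P 0)) => [->//|i0]; case: (altP (i =P 1)) => [->//|i1].
suff -> : i = 2 by [].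
by case: i i0 i1 => [[|[|[|]]]] //= *; apply/val_inj.
Qed.

Lemma big_I3 (R : nmodType) (F : 'I_3 -> R) : \sum_i F i = F 0 + F 1 + F 2.
Proof.
rewrite !big_ord_recl big_ord0 addr0 addrA.
by congr (_ + F _ + F _); apply/val_inj.
Qed.

Lemma det2 (R : comNzRingType) (A : 'M[R]_2) :
  \det A = A 0 0 * A 1 1 - A 0 1 * A 1 0.
Proof.
rewrite (expand_det_row _ ord0) !big_ord_recl big_ord0 addr0 /cofactor !det_mx11 !mxE /=.
rewrite expr0 mul1r expr1 mulN1r mulrN.
by congr (A _ _ * A _ _ - A _ _ * A _ _); apply/val_inj.
Qed.
Lemma det3 (R : comNzRingType) (A : 'M[R]_3) :
  \det A = A 0 0 * (A 1 1 * A 2 2 - A 1 2 * A 2 1)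
         - A 0 1 * (A 1 0 * A 2 2 - A 1 2 * A 2 0)
         + A 0 2 * (A 1 0 * A 2 1 - A 1 1 * A 2 0).
Proof.
rewrite (expand_det_row _ 0) big_I3 /cofactor !det2 !mxE /=.
rewrite expr0 mul1r expr1 mulN1r mulrN sqrrN expr1n mul1r.
by congr (A _ _ * (A _ _ * A _ _ - A _ _ * A _ _) - A _ _ * (A _ _ * A _ _ - A _ _ * A _ _) + A _ _ * (A _ _ * A _ _ - A _ _ * A _ _)); apply/val_inj.
Qed.

Definition fmap (K : comNzRingType) (a b c d : K) (v : 'I_3 -> K) : 'I_3 -> K :=
  pt3 (v 0 ^+ 2 + a * v 0 * v 2 + b * v 1 * v 2)
      (v 1 ^+ 2 + c * v 0 * v 2 + d * v 1 * v 2) (v 2 ^+ 2).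

Lemma apply_fabcd a b c d v :
  apply_map (fabcd a b c d) v =1 fmap (ratr a) (ratr b) (ratr c) (ratr d) v.
Proof.
apply: forall_I3; rewrite /apply_map /fabcd /fmap /pt3 /=;
by rewrite ?(mevalD, mevalM, mevalC, mevalXU, rmorphXn) /= ?mevalXU.
Qed.

Lemma jacobian_fabcd a b c d v i j :
  (jacobian (fabcd a b c d) i j).@[v] =
  pt3 (pt3 (2 * v 0 + ratr a * v 2) (ratr b * v 2) (ratr a * v 0 + ratr b * v 1))
      (pt3 (ratr c * v 2) (2 * v 1 + ratr d * v 2) (ratr c * v 0 + ratr d * v 1))
      (pt3 0 0 (2 * v 2)) i j.
Proof.
have X k l : (mderiv l 'X_k : {mpoly algC[3]}) = (k == l)%:R.
  rewrite mderivX mnm1E; case: eqP => [->|_]; last by rewrite scale0r.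
  by rewrite -{1}[U_(l)%MM]add0m addmK mpolyX0 scale1r.
rewrite mxE; move: i j; apply: forall_I3; apply: forall_I3;
rewrite /fabcd /pt3 /= ?expr2 ?(mderivD, mderivM, mderivC, X) /=;
rewrite ?(mevalD, mevalM, mevalC, mevalXU, meval0, meval1, mevalMn) /=; ring.
Qed.

Lemma critical_fabcdE a b c d v :
  (\det (jacobian (fabcd a b c d))).@[v] =
  2 * v 2 * ((2 * v 0 + ratr a * v 2) * (2 * v 1 + ratr d * v 2)
             - ratr b * ratr c * v 2 ^+ 2).
Proof.
have E i j : map_mx (meval v) (jacobian (fabcd a b c d)) i j =
    (jacobian (fabcd a b c d) i j).@[v] by rewrite mxE.
by rewrite -det_map_mx det3 !E !jacobian_fabcd /pt3 /=; ring.
Qed.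

(* Quadratic maps satisfy [F (v + w) = F v + F w + DF_v w], so criticality can
   be expressed without derivatives. *)
Lemma critical_polar a b c d v :
  critical_pt (fabcd a b c d) v <->
  nonzero_pt v /\ exists w : pt, nonzero_pt w /\
    forall i, apply_map (fabcd a b c d) (fun j => v j + w j) i =
              apply_map (fabcd a b c d) v i + apply_map (fabcd a b c d) w i.
Proof.
pose A : 'M[algC]_3 := \matrix_(j, i) (jacobian (fabcd a b c d) i j).@[v].
have -> : critical_pt (fabcd a b c d) v <-> nonzero_pt v /\ \det A = 0.
  rewrite /critical_pt -det_map_mx -det_tr.
  suff -> : (map_mx (meval v) (jacobian (fabcd a b c d)))^T = A by [].
  by apply/matrixP => i j; rewrite mxE [RHS]mxE mxE.
have AE j i : A j i = (jacobian (fabcd a b c d) i j).@[v] by rewrite mxE.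
have polar (w : 'rV_3) i : apply_map (fabcd a b c d) (fun j => v j + w 0 j) i =
    apply_map (fabcd a b c d) v i + apply_map (fabcd a b c d) (w 0) i + (w *m A) 0 i.
  rewrite mxE big_I3 !AE !jacobian_fabcd !apply_fabcd.
  by move: i; apply: forall_I3; rewrite /fmap /pt3 /=; ring.
split=> -[v0 H]; split=> //.
  move/eqP/det0P: H => [w w0 wA]; exists (w 0); split.
    by case/rV0Pn: w0 => i wi; exists i.
  by move=> i; rewrite polar wA mxE addr0.
case: H => w [[i wi] H]; apply/eqP/det0P; exists (\row_j w j).
  by apply/rV0Pn; exists i; rewrite mxE.
apply/rowP => k; have := polar (\row_j w j) k.
have E : forall u, (apply_map (fabcd a b c d) (fun j => u j + (\row_j w j) 0 j) k =
    apply_map (fabcd a b c d) (fun j => u j + w j) k).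
  by move=> u; apply: meval_eq => j; rewrite mxE.
have E1 : apply_map (fabcd a b c d) ((\row_j w j) 0) k = apply_map (fabcd a b c d) w k.
  by apply: meval_eq => j; rewrite mxE.
rewrite E E1 H => /eqP; rewrite -subr_eq0 opprD addNKr oppr_eq0 => /eqP ->.
by rewrite mxE.
Qed.

(** * Images of the critical branch *)

Lemma poly_valuation1 (K : fieldType) (p : {poly K}) :
  p.[0] = 0 -> p^`().[0] != 0 -> exists2 q : {poly K}, q.[0] != 0 & p = 'X * q.
Proof.
move=> p0; have /factor_theorem[q ->] : root p 0 by rewrite /root p0.
rewrite polyC0 subr0 derivM derivX hornerD !hornerM hornerX hornerC mulr0 add0r mulr1.
by move=> q0; exists q; rewrite // mulrC.
Qed.

Lemma modX2_deriv (K : fieldType) n (p : {poly K}) :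
  (1 < n)%N -> 'X^n %| p -> p^`().[0] = 0.
Proof.
move=> n1 /dvdpP[q ->]; case: n n1 => [|[|n]] // _.
have -> : q * 'X^(n.+2) = 'X * ('X * (q * 'X^n)) by rewrite !exprS; ring.
by rewrite derivM derivX hornerD !hornerM hornerX !mul0r mulr0 addr0.
Qed.

Section CriticalBranch.
Variables (K : numFieldType) (al b c de k : K).
Let a := 2 * al.
Let d := 2 * de.

(* The branch of the conic at [1:0:0] is parametrised by
   [1 - al t : - de t + k t^2 : t] with 4 k = bc, and its image after n + 1
   iterations by [A_n : w B_n : w^2] with w = t^(2^n); see [iter_branch]. *)
Fixpoint branch n : {poly K} * {poly K} :=
  if n is n'.+1 then
    let: (A, B) := branch n' in let w := 'X^(2 ^ n') in
    (A ^+ 2 + a *: (A * w ^+ 2) + b *: (w ^+ 3 * B), B ^+ 2 + c *: A + d *: (w * B))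
  else (1 - (al ^+ 2 + b * de) *: 'X^2 + (b * k) *: 'X^3,
        c%:P - (c * al + de ^+ 2) *: 'X + k ^+ 2 *: 'X^3).

Notation bA n := (branch n).1.
Notation bB n := (branch n).2.

Lemma branchAS n : bA n.+1 = bA n ^+ 2 + a *: (bA n * 'X^(2 ^ n) ^+ 2)
  + b *: ('X^(2 ^ n) ^+ 3 * bB n).
Proof. by rewrite /=; case: branch. Qed.

Lemma branchBS n : bB n.+1 = bB n ^+ 2 + c *: bA n + d *: ('X^(2 ^ n) * bB n).
Proof. by rewrite /=; case: branch. Qed.

Lemma fmap_eq (v w : 'I_3 -> K) : v =1 w -> fmap a b c d v =1 fmap a b c d w.
Proof. by move=> vw; apply: forall_I3; rewrite /fmap /pt3 /= !vw. Qed.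

Lemma iter_branch n t :
  iter n.+1 (fmap a b c d) (pt3 (1 - al * t) (- de * t + k * t ^+ 2) t) =1
  pt3 (bA n).[t] (t ^+ (2 ^ n) * (bB n).[t]) (t ^+ (2 * 2 ^ n)).
Proof.
elim: n => [|n IH].
  apply: forall_I3; rewrite /= /fmap /pt3 /= ?muln1 ?expr1 //;
    rewrite !(hornerD, hornerN, hornerZ, hornerXn, hornerX, hornerC) /a /d; ring.
move=> i; rewrite iterS (fmap_eq IH) branchAS branchBS; move: i.
have E1 : t ^+ (2 ^ n.+1) = (t ^+ (2 ^ n)) ^+ 2 by rewrite -exprM expnSr.
have E2 m : t ^+ (2 * m) = (t ^+ m) ^+ 2 by rewrite -exprM mulnC.
apply: forall_I3; rewrite /fmap /pt3 /= !E2 ?E1;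
  rewrite ?(hornerD, hornerZ, hornerM, horner_exp) ?hornerX; ring.
Qed.

Lemma branch0 n : (bA n).[0] = 1 /\
  (bB n).[0] = iter n (fun z => z ^+ 2 + c) c.
Proof.
elim: n => [|n [IA IB]].
  rewrite /=; split; rewrite ?(hornerD, hornerN, hornerZ, hornerXn, hornerX, hornerC);
    rewrite !expr0n /=; ring.
have w0 : ('X^(2 ^ n) : {poly K}).[0] = 0 by rewrite hornerXn expr0n expn_eq0.
rewrite branchAS branchBS /= -IB; move: ('X^(2 ^ n)) w0 => w w0; split;
rewrite !(hornerD, hornerZ, hornerM, horner_exp) w0 IA; ring.
Qed.

Lemma branchA0 n : (bA n).[0] = 1. Proof. by case: (branch0 n). Qed.

Definition trapped := exists (D : nat) (G : {mpoly K[3]}),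
  [/\ G != 0, G \is D.-homog & forall n t,
   G.@[pt3 (bA n).[t] (t ^+ (2 ^ n) * (bB n).[t]) (t ^+ (2 * 2 ^ n))] = 0].

Hypothesis trap : trapped.

(** The images have coordinates [y = w B_n] and [z = w^2], which calls for the weight [e = 2]. At
    [X = 0] the leading form is evaluated at [B_n(0)], a point of the critical orbit of
    [z^2 + c]. *)
Lemma branchB_finite : exists2 h : {poly K}, h != 0 &
  forall n, h.[iter n (fun z => z ^+ 2 + c) c] = 0.
Proof.
have [D [G [G0 hG GE]]] := trap.
have [h h0 H] := @weighted_leading_form K 2 D G isT G0 hG.
exists h => // n; have [A0 <-] := branch0 n.
have [r [r0 _ /dvdpP[q]]] := H _ _ _ A0 (GE n).
move=> /(congr1 (fun p => p.[0])).
by rewrite horner_comp !hornerM hornerXn expr0n expn_eq0 /= r0 mul1r mulr0.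
Qed.

(* If the expansion B_n / sqrt A_n differs from [beta], its distance to [beta] is
   bounded in terms of the curve containing all the images. *)
Lemma valuation_bound (beta : K) : exists C : nat, forall n, exists r : {poly K},
  [/\ r.[0] = 1, 'X^(2 ^ n) %| r ^+ 2 * bA n - 1 &
   forall (v : nat) (q : {poly K}), (0 < v)%N -> q.[0] != 0 ->
     r * bB n - beta%:P = 'X^v * q -> (2 ^ n <= v * C)%N].
Proof.
have [D [G [G0 hG GE]]] := trap.
have [h h0 H] := @weighted_leading_form K 2 D G isT G0 hG.
have [C [h1]] := multiplicity_XsubC h beta; rewrite h0 /= => h1b hE.
exists C => n; have [r [r0 rA Hh]] := H _ _ _ (branchA0 n) (GE n).
exists r; split=> // v q v0 q0 E; move: Hh.
rewrite expr1 hE comp_polyM rmorphXn /= comp_polyB comp_polyX comp_polyC E.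
have rB0 : (r * bB n).[0] = beta.
  have := congr1 (fun p => p.[0]) E.
  rewrite hornerD hornerN hornerC !hornerM hornerXn expr0n.
  rewrite (gtn_eqF v0) mul0r => /eqP; rewrite subr_eq0 => /eqP.
  by [].
(* [h1] does not vanish at [beta], so its composite is prime to [X]; only the factor [(X^v q)^C] can
   absorb [X^(2^n)]. *)
rewrite Gauss_dvdpr; last first.
  by apply: coprime_Xn; rewrite horner_comp rB0.
rewrite exprMn Gauss_dvdpl; last by apply: coprime_Xn; rewrite horner_exp expf_neq0.
by rewrite -exprM dvdp_Pexp2l // size_polyX.
Qed.
End CriticalBranch.

(** * Constraints on the coefficients *)

Lemma roots_repeat (K : idomainType) (h : {poly K}) (s : nat -> K) :
  h != 0 -> (forall n, h.[s n] = 0) -> exists i j, (i < j)%N /\ s i = s j.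
Proof.
move=> h0 hs; pose t := [seq s i | i <- iota 0 (size h)].
have : ~~ uniq t.
  apply/negP => ut; case/eqP: h0; apply: roots_geq_poly_eq0 ut _.
    by apply/allP => x /mapP[i _ ->]; rewrite /root hs.
  by rewrite size_map size_iota.
case/(uniqPn 0) => i [j [ij]]; rewrite size_map size_iota => js.
have ks := ltn_trans ij js.
by rewrite !(nth_map 0%N) ?size_iota // !nth_iota // => E; exists i, j.
Qed.

Section Constraints.
Variables (K : numFieldType) (al b c de k : K).
Notation br := (branch al b c de k).
Notation bA n := (br n).1.
Notation bB n := (br n).2.
Hypothesis trap : trapped al b c de k.

Lemma trapped_critical_orbit :
  exists i j, (i < j)%N /\
    iter i (fun z => z ^+ 2 + c) c = iter j (fun z => z ^+ 2 + c) c.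
Proof. by have [h h0 /(roots_repeat h0)] := branchB_finite trap. Qed.

Lemma branchA_deriv0 n : (bA n)^`().[0] = 0.
Proof.
elim: n => [|n IH].
  rewrite /= !(derivD, derivN, derivZ, derivXn, derivC) /=.
  by rewrite !(hornerD, hornerN, hornerZ, hornerMn, hornerXn, hornerC) /=; ring.
have w0 : ('X^(2 ^ n) : {poly K}).[0] = 0 by rewrite hornerXn expr0n expn_eq0.
rewrite branchAS !exprS !expr0 !mulr1; move: ('X^(2 ^ n)) w0 => w w0.
rewrite !(derivD, derivZ, derivM) !(hornerD, hornerZ, hornerM) IH w0; ring.
Qed.

(** For [n > 0] the term [d w B_n] is divisible by [X^2]. For [n = 0], where [w = X], it adds a
    linear term, so that case is computed separately. *)
Lemma branchB_deriv0 n : (0 < n)%N ->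
  (bB n.+1)^`().[0] = 2 * (bB n).[0] * (bB n)^`().[0].
Proof.
move=> n0; rewrite branchBS expr2 !(derivD, derivZ, derivM).
rewrite !(hornerD, hornerZ, hornerM) branchA_deriv0 derivXn hornerXn expr0n.
rewrite expn_eq0 /= hornerMn hornerXn expr0n.
have -> : ((2 ^ n).-1 == 0)%N = false.
  by case: n n0 => // n _; rewrite expnS; have := expn_gt0 2 n; lia.
by rewrite mul0rn; ring.
Qed.

Lemma branchB1_deriv0 :
  (bB 1)^`().[0] = - 2 * c * (c * al + de ^+ 2) + 2 * de * c.
Proof.
rewrite branchBS; have := branchA_deriv0 0; have [_] := branch0 al b c de k 0.
have : (bB 0)^`().[0] = - (c * al + de ^+ 2).
  rewrite /= !(derivD, derivN, derivZ, derivX, derivXn, derivC) /=.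
  by rewrite !(hornerD, hornerN, hornerZ, hornerMn, hornerXn, hornerC) !expr0n /=; ring.
move: (bA 0) (bB 0) => A B B' B0 A'.
rewrite !expr2 expr1 !(derivD, derivZ, derivM) derivX.
rewrite !(hornerD, hornerZ, hornerM) hornerX hornerC A' B' B0 /=; ring.
Qed.

(* For c = -1 the ratio v / 2^n of the order of vanishing of B_n to that of w would
   be halved every second step, contradicting [valuation_bound]. *)
Lemma escape n v (q : {poly K}) : c = -1 -> (0 < v < 2 ^ n)%N -> q.[0] != 0 ->
  bB n <> 'X^v * q.
Proof.
move=> c1; have [C HC] := valuation_bound trap 0.
(* Two steps follow the cycle 0, -1, 0 of [z^2 - 1]: [B_(m+1) = X^(2u) T - A_m], and squaring leaves
   [-2 X^(2u) T A_m] as the lowest term of [B_(m+2)], since [A_m^2] cancels. *)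
have step m u (p : {poly K}) : (0 < u < 2 ^ m)%N -> p.[0] != 0 ->
    bB m = 'X^u * p -> exists2 p' : {poly K}, p'.[0] != 0 & bB m.+2 = 'X^(2 * u) * p'.
  move=> /andP[u0 um] p0 E.
  have A0 := branchA0 al b c de k m.
  have [s s0 Es] : exists2 s, (0 < s)%N & (2 ^ m = u + s)%N.
    by exists (2 ^ m - u)%N; lia.
  have X0 i : (0 < i)%N -> exists2 x : {poly K}, 'X^i = x & x.[0] = 0.
    by move=> i0; exists 'X^i; rewrite // hornerXn expr0n eqn0Ngt i0.
  have [[x xE x0] [y yE y0]] := (X0 u u0, X0 s s0).
  have wE : 'X^(2 ^ m) = x * y by rewrite Es exprD xE yE.
  pose T := p ^+ 2 + (2 * de) *: (y * p).
  pose S := x ^+ 2 * T.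
  exists (x ^+ 2 * T ^+ 2 - 2%:R *: (T * bA m)
    - (2 * al) *: (bA m * y ^+ 2) - b *: (x ^+ 2 * y ^+ 3 * p)
    + (2 * de) *: (y ^+ 2 * (S - bA m))).
    rewrite !(hornerD, hornerN, hornerZ, hornerM, horner_exp) x0 y0 A0.
    rewrite (_ : _ + _ = - 2%:R * p.[0] ^+ 2); last by ring.
    by rewrite mulf_neq0 ?oppr_eq0 ?pnatr_eq0 // expf_neq0.
  rewrite branchBS branchAS branchBS expnSr exprM wE E c1 mulnC exprM xE /S /T.
  by rewrite -!mul_polyC; move: (2 * de)%:P (2 * al)%:P => dd aa; ring.
move=> vn q0 E.
have main j : exists2 p : {poly K}, p.[0] != 0 & bB (n + j.*2) = 'X^(2 ^ j * v) * p.
  elim: j => [|j [p p0 IH]]; first by exists q; rewrite ?addn0 ?mul1n.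
  have [|p' p'0 E'] := step _ _ _ _ p0 IH; last first.
    by exists p' => //; rewrite doubleS !addnS E' expnS mulnA.
  have /andP[v0 vn'] := vn; rewrite muln_gt0 expn_gt0 v0 /=.
  rewrite -addnn !expnD mulnCA ltn_pmul2l ?expn_gt0 //.
  by rewrite (leq_trans vn') // leq_pmulr ?expn_gt0.
(* With [j = v C] the bound reads [2^(n + 2j) <= 2^j j], which contradicts [j < 2^j]. *)
have [p p0 Ep] := main (v * C)%N.
have [r [r0 _ Hr]] := HC (n + (v * C).*2)%N.
have := Hr (2 ^ (v * C) * v)%N (r * p).
have /andP[v0 vn'] := vn.
rewrite muln_gt0 expn_gt0 v0 hornerM r0 mul1r => /(_ isT p0).
rewrite polyC0 subr0 Ep => /(_ (mulrCA _ _ _)).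
rewrite -addnn !expnD mulnA -!mulnA mulnCA leq_pmul2l ?expn_gt0 //.
have := ltn_expl (v * C) (isT : (1 < 2)%N).
have : (0 < 2 ^ n)%N by rewrite expn_gt0.
by nia.
Qed.

(** For [n > 0] the constant term of [B_n] is the fixed point 2 of [z^2 - 2], whose multiplier is 4.
    A nonzero linear term of [B_1] thus persists, keeping the distance to 2 at order 1, against
    [valuation_bound]. *)
Lemma trapped_c2 : c = - 2%:R -> 2 * al = de ^+ 2 - de.
Proof.
move=> c2; apply/eqP; rewrite -subr_eq0; apply/eqP.
set g := (X in X = 0); apply/eqP/negPn/negP => g0.
have Bn n : (bB n.+1).[0] = 2%:R.
  have [_ ->] := branch0 al b c de k n.+1.
  rewrite c2; elim: n => [|n IH]; first by rewrite /=; ring.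
  by rewrite iterS IH; ring.
have B'n n : (bB n.+1)^`().[0] != 0.
  elim: n => [|n IH].
    rewrite branchB1_deriv0 c2 (_ : _ + _ = - 4%:R * g); last by rewrite /g; ring.
    by rewrite mulf_neq0 // oppr_eq0 pnatr_eq0.
  by rewrite branchB_deriv0 // Bn !mulf_neq0 ?pnatr_eq0.
have [C HC] := valuation_bound trap 2%:R.
have [r [r0 rA Hr]] := HC C.+1.
(* The normalising factor has no linear term, so it leaves that of [B_n] unchanged. *)
have r'0 : r^`().[0] = 0.
  have /(modX2_deriv _) : 'X^(2 ^ C.+1) %| r ^+ 2 * bA C.+1 - 1 by [].
  rewrite expnS leq_pmulr ?expn_gt0 // => /(_ isT).
  rewrite expr2 derivB derivC subr0 !derivM hornerD !(hornerM, hornerD) r0.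
  rewrite branchA_deriv0 branchA0 => /eqP.
  rewrite (_ : _ + _ = 2%:R * r^`().[0]); last by ring.
  by rewrite mulf_eq0 pnatr_eq0 /= => /eqP.
have [||q q0 E] := @poly_valuation1 _ (r * bB C.+1 - 2%:R%:P).
- by rewrite hornerD hornerN hornerC hornerM r0 Bn mul1r subrr.
- by rewrite derivB derivC subr0 derivM hornerD !hornerM r'0 mul0r add0r r0 mul1r.
have := Hr 1%N q isT q0; rewrite expr1 mul1n => /(_ E).
by have := ltn_expl C.+1 (isT : (1 < 2)%N); lia.
Qed.

(** [B_1] vanishes at 0; if its linear coefficient were nonzero, its order 1 would be below [2^1],
    which [escape] forbids. *)
Lemma trapped_c1_deriv : c = -1 -> al = de ^+ 2 - de.
Proof.
move=> c1; apply/eqP; rewrite -subr_eq0; apply/eqP.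
set g := (X in X = 0); apply/eqP/negPn/negP => g0.
have [||q q0] := @poly_valuation1 _ (bB 1).
- have [_ ->] := branch0 al b c de k 1; rewrite /= c1; ring.
- rewrite branchB1_deriv0 c1 (_ : _ + _ = - 2%:R * g); last by rewrite /g; ring.
  by rewrite mulf_neq0 // oppr_eq0 pnatr_eq0.
by rewrite -['X]expr1; apply: escape.
Qed.

(** Once the linear term of [B_1] is gone, [B_3] has order 4 unless [nu = 0], and then order 6
    unless [k = 0]. Both orders are below [2^3], so [escape] forces both equations. *)
Lemma trapped_c1 : c = -1 -> b * c = 4%:R * k -> b = 0 /\ al ^+ 2 = al.
Proof.
move=> c1 bk; have aE := trapped_c1_deriv c1.
have bE : b = - 4%:R * k by rewrite mulNr -bk c1 mulrN1 opprK.
have [nu nuE] : exists nu, nu = al ^+ 2 - al + b * de by eexists.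
have [E EE] : exists E : {poly K}, E = (2 * k ^+ 2)%:P + (k ^+ 4)%:P * 'X^3 by eexists.
have E0 : E.[0] = 2 * k ^+ 2.
  by rewrite EE hornerD hornerM !hornerC hornerXn expr0n mulr0 addr0.
have B1 : bB 1 = 'X^2 * ((nu - de)%:P + 'X * E).
  rewrite branchBS /= expr1 -!mul_polyC c1 EE nuE bE aE.
  rewrite !(polyCD, polyCN, polyCM, rmorphXn, rmorphB) /= polyC1.
  by move: de%:P k%:P => dd kk; ring.
(* With [B_1 = X^2 F], the low part of [B_3] is [-2 A (F^2 + 2 de F + al + de)]; the relation
   [al = de^2 - de] makes the bracket the square of [F + de]. *)
have [A [T [A0 B3]]] : exists A T : {poly K}, A.[0] = 1 /\
    bB 3 = 'X^4 * ('X^4 * T - 2%:R *: (A * (nu%:P + 'X * E) ^+ 2)).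
  pose F := (nu - de)%:P + 'X * E; pose S := F ^+ 2 + (2 * de)%:P * F.
  exists (bA 1), (S ^+ 2 - b%:P * F + (2 * de)%:P * S).
  split; first exact: branchA0.
  rewrite branchBS branchAS branchBS B1; move: (bA 1) => A.
  rewrite c1 aE -!mul_polyC.
  rewrite /S /F !(polyCD, polyCN, polyCM, rmorphXn, rmorphB) /= polyC1.
  by move: nu%:P de%:P b%:P => nn dd bb; ring.
have nu0 : nu = 0.
  apply/eqP/negPn/negP => nu0; apply: (@escape 3 4 _ c1 isT _ B3).
  rewrite hornerD hornerM hornerXn expr0n mul0r add0r hornerN hornerZ oppr_eq0.
  rewrite hornerM A0 mul1r horner_exp hornerD hornerM hornerX mul0r addr0 hornerC.
  by rewrite mulf_neq0 ?expf_neq0 ?pnatr_eq0.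
have k0 : k = 0.
  apply/eqP/negPn/negP => k0.
  apply: (@escape 3 6 ('X^2 * T - 2%:R *: (A * E ^+ 2)) c1 isT).
    rewrite hornerD hornerM hornerXn expr0n mul0r add0r hornerN hornerZ oppr_eq0.
    rewrite hornerM A0 mul1r horner_exp E0.
    by rewrite !mulf_neq0 ?expf_neq0 ?mulf_neq0 ?expf_neq0 ?pnatr_eq0.
  by rewrite B3 nu0 polyC0 add0r -!mul_polyC; ring.
have b0 : b = 0 by rewrite bE k0 mulr0.
split=> //; apply/eqP; rewrite -subr_eq0.
by move: nu0; rewrite nuE b0 mul0r addr0 => ->.
Qed.
End Constraints.

(* For c = 0 the branch is the line y = -d/2; the translation by d/2 conjugates
   y^2 + dy to z^2 + de - de^2, and the line is mapped to horizontal lines. *)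
Lemma trapped_line (K : numFieldType) (al b de : K) : trapped al b 0 de 0 ->
  let f z := z ^+ 2 + (de - de ^+ 2) in
  exists i j, (i < j)%N /\ iter i f (de - de ^+ 2) = iter j f (de - de ^+ 2).
Proof.
move=> [D [G [G0 hG GE]]] f.
have BE n : (branch al b 0 de 0 n).2 =
    (iter n f (de - de ^+ 2) - de) *: 'X^(2 ^ n).
  elim: n => [|n IH].
    rewrite /= expn0 expr1 -!mul_polyC expr0n /=.
    rewrite !(polyCD, polyCN, polyCM, rmorphXn, rmorphB, polyC0) /=; ring.
  rewrite branchBS IH iterS scale0r addr0 -!mul_polyC [in RHS]expnSr exprM.
  rewrite /f !(polyCD, polyCN, polyCM, rmorphXn, rmorphB) /=.
  by move: (iter n _ _)%:P de%:P ('X^(2 ^ n)) => u v w; ring.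
(* On a horizontal line [y] and [z] vanish to the same order at [[1:0:0]], hence the weight 1. *)
have [h h0 H] := @weighted_leading_form K 1 D G isT G0 hG.
have [n|i [j [ij E]]] := @roots_repeat K h (fun n => iter n f (de - de ^+ 2) - de) h0.
  set y := _ - de.
  have [t|r [_ _]] := H _ y%:P (2 * 2 ^ n)%N (branchA0 al b 0 de 0 n).
    rewrite mul1n -[RHS](GE n t) BE; apply: meval_eq.
    apply: forall_I3; rewrite /pt3 //= hornerC hornerZ hornerXn mulnC exprM -/y; ring.
  rewrite expr0 mul1r comp_polyCr => /dvdpP[q /(congr1 (fun p => p.[0]))].
  by rewrite hornerC hornerM hornerXn expr0n muln_eq0 expn_eq0 /= mulr0.
by exists i, j; split=> //; exact: addIr E.
Qed.

(** * Invariance under conjugation *)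

Lemma iter_apply_fabcd a b c d n v :
  iter n (apply_map (fabcd a b c d)) v =1
  iter n (fmap (ratr a) (ratr b) (ratr c) (ratr d)) v.
Proof.
elim: n => // n IH i; rewrite !iterS apply_fabcd.
by move: i; apply: forall_I3; rewrite /fmap /pt3 /= !IH.
Qed.

Lemma pcf_trapped a b c d : pcf (fabcd a b c d) ->
  trapped (ratr a / 2) (ratr b) (ratr c) (ratr d / 2) (ratr b * ratr c / 4 : algC).
Proof.
move=> [D [G [G0 [hG crit]]]]; exists D, G; split=> // n t.
have half (x : algC) : 2 * (x / 2) = x by field.
pose v := pt3 (1 - ratr a / 2 * t)
  (- (ratr d / 2) * t + ratr b * ratr c / 4 * t ^+ 2) (t : algC).
have /crit H : critical_pt (fabcd a b c d) v.
  split; last by rewrite critical_fabcdE /v /pt3 /=; field.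
  have [t0|t0] := eqVneq t 0; last by exists 2; rewrite /v /pt3.
  by exists 0; rewrite /v /pt3 /= t0 mulr0 subr0 oner_eq0.
rewrite -[RHS](H n.+1 isT); apply: meval_eq => i.
have := iter_branch (ratr a / 2) (ratr b) (ratr c) (ratr d / 2)
  (ratr b * ratr c / 4) n t i.
by rewrite !half iter_apply_fabcd.
Qed.

Lemma mpoly3_eq0 (K : numFieldType) D (G : {mpoly K[3]}) :
  G \is D.-homog -> (forall v, G.@[v] = 0) -> G = 0.
Proof.
move=> hG Gv; apply/eqP/negPn/negP => G0.
have [h /eqP h0 H] := @weighted_leading_form K 1 D G isT G0 hG; case: h0.
apply: poly_eq0_horner => x.
have [t|r [_ _]] := H 1 x%:P 1%N (hornerC 1 0); first exact: Gv.
rewrite expr0 mul1r comp_polyCr => /dvdpP[q /(congr1 (fun p => p.[0]))].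
by rewrite hornerC hornerM hornerX mulr0.
Qed.

Lemma meval_homog (K : numFieldType) D (G : {mpoly K[3]}) (l : K) v :
  G \is D.-homog -> G.@[fun i => l * v i] = l ^+ D * G.@[v].
Proof.
move=> hG; rewrite !mevalE big_distrr; apply: eq_big_seq => m mG /=.
rewrite mulrCA; congr (_ * _).
rewrite (eq_bigr _ (fun i _ => exprMn (m i) l (v i))) big_split; congr (_ * _).
rewrite (mdeg_supp hG mG) /= !big_ord_recl big_ord0 mulr1 !exprD /=.
by congr (_ ^+ _ * (_ ^+ _ * _ ^+ _)); congr (fun_of_multinom m); apply/val_inj.
Qed.

Section LinearForms.
Implicit Types f g : pt -> algC.

(** Forms are predicates on functions, so that they apply directly to composites of [lin_act] and
    [apply_map]. *)
Definition linear_form f := exists c0 c1 c2, forall v, f v = c0 * v 0 + c1 * v 1 + c2 * v 2.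
Definition quadratic_form f := exists c00 c11 c22 c01 c02 c12, forall v,
  f v = c00 * v 0 ^+ 2 + c11 * v 1 ^+ 2 + c22 * v 2 ^+ 2
      + c01 * v 0 * v 1 + c02 * v 0 * v 2 + c12 * v 1 * v 2.

Lemma linear_form_coord i : linear_form (fun v => v i).
Proof.
move: i; apply: forall_I3; [exists 1, 0, 0|exists 0, 1, 0|exists 0, 0, 1] => v; ring.
Qed.

Lemma linear_form_act (M : 'M[algC]_3) i : linear_form (fun v => lin_act M v i).
Proof. by exists (M i 0), (M i 1), (M i 2) => v; rewrite /lin_act big_I3. Qed.

Lemma quadratic_formM f g : linear_form f -> linear_form g ->
  quadratic_form (fun v => f v * g v).
Proof.
move=> [x [y [z Ef]]] [x' [y' [z' Eg]]].
exists (x * x'), (y * y'), (z * z'), (x * y' + y * x'), (x * z' + z * x'), (y * z' + z * y').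
by move=> v; rewrite Ef Eg; ring.
Qed.

Lemma quadratic_formD f g : quadratic_form f -> quadratic_form g ->
  quadratic_form (fun v => f v + g v).
Proof.
move=> [c0 [c1 [c2 [c3 [c4 [c5 Ef]]]]]] [e0 [e1 [e2 [e3 [e4 [e5 Eg]]]]]].
exists (c0 + e0), (c1 + e1), (c2 + e2), (c3 + e3), (c4 + e4), (c5 + e5).
by move=> v; rewrite Ef Eg; ring.
Qed.

Lemma quadratic_formZ l f : quadratic_form f -> quadratic_form (fun v => l * f v).
Proof.
move=> [c0 [c1 [c2 [c3 [c4 [c5 Ef]]]]]].
exists (l * c0), (l * c1), (l * c2), (l * c3), (l * c4), (l * c5).
by move=> v; rewrite Ef; ring.
Qed.

Lemma quadratic_form_ext f g : f =1 g -> quadratic_form f -> quadratic_form g.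
Proof.
move=> fg [c0 [c1 [c2 [c3 [c4 [c5 Ef]]]]]]; exists c0, c1, c2, c3, c4, c5.
by move=> v; rewrite -fg.
Qed.

Lemma quadratic_form_act (M : 'M[algC]_3) (F : pt -> pt) i :
  (forall j, quadratic_form (fun v => F v j)) ->
  quadratic_form (fun v => lin_act M (F v) i).
Proof.
move=> qF; apply: (@quadratic_form_ext
  (fun v => M i 0 * F v 0 + M i 1 * F v 1 + M i 2 * F v 2)).
  by move=> v; rewrite /lin_act big_I3.
by do 2?apply: quadratic_formD; apply: quadratic_formZ.
Qed.

Lemma quadratic_form_fabcd a b c d (u : pt -> pt) i :
  (forall j, linear_form (fun v => u v j)) ->
  quadratic_form (fun v => apply_map (fabcd a b c d) (u v) i).
Proof.
move=> lu; have M j k := quadratic_formM (lu j) (lu k).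
have Z l j k := quadratic_formZ l (M j k).
pose f r s j v := u v j * u v j + r * (u v 0 * u v 2) + s * (u v 1 * u v 2).
have qf r s j : quadratic_form (f r s j) by rewrite /f; do 2?apply: quadratic_formD.
move: i; apply: forall_I3.
- apply: quadratic_form_ext (qf (ratr a) (ratr b) 0) => v.
  by rewrite apply_fabcd /fmap /pt3 /f /=; ring.
- apply: quadratic_form_ext (qf (ratr c) (ratr d) 1) => v.
  by rewrite apply_fabcd /fmap /pt3 /f /=; ring.
- by apply: quadratic_form_ext (M 2 2) => v; rewrite apply_fabcd /fmap /pt3 /= expr2.
Qed.

Lemma quadratic_form_eq f g : quadratic_form f -> quadratic_form g ->
  (forall v, v 2 != 0 -> f v = g v) -> f =1 g.
Proof.
move=> qf /(quadratic_formZ (-1)) qg fg v.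
have [c0 [c1 [c2 [c3 [c4 [c5 E]]]]]] := quadratic_formD qf qg.
have [v2|v2] := eqVneq (v 2) 0; last exact: fg.
have Z x y z : z != 0 -> c0 * x ^+ 2 + c1 * y ^+ 2 + c2 * z ^+ 2
      + c3 * x * y + c4 * x * z + c5 * y * z = 0.
  by move=> z0; have := E (pt3 x y z); rewrite fg // mulN1r subrr /pt3 /= => <-.
have := Z (v 0) (v 1) 1 (oner_neq0 _); have := Z (v 0) (v 1) (-1).
rewrite oppr_eq0 oner_eq0 => /(_ isT) Zm Zp.
have Z0 := Z 0 0 1 (oner_neq0 _).
apply/eqP; rewrite -subr_eq0 -mulN1r E v2; apply/eqP.
have c20 : c2 = 0 by rewrite -Z0; ring.
apply: (@mulfI _ 2); rewrite ?pnatr_eq0 //.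
(* Adding the values at [z = 1] and [z = -1] removes the terms odd in [z]. *)
have E1 := congr2 +%R Zp Zm.
rewrite [RHS]mulr0 -[RHS](addr0 0) -[RHS]E1 c20; ring.
Qed.
End LinearForms.

Lemma lin_act_comp (M N : 'M[algC]_3) v : lin_act M (lin_act N v) =1 lin_act (M *m N) v.
Proof. by move=> i; rewrite /lin_act !big_I3 !mxE !big_I3; ring. Qed.

Lemma lin_act1 v : lin_act 1%:M v =1 v.
Proof. by apply: forall_I3; rewrite /lin_act big_I3 !mxE /=; ring. Qed.

Lemma lin_act_eq (M : 'M[algC]_3) u v : u =1 v -> lin_act M u =1 lin_act M v.
Proof. by move=> uv i; rewrite /lin_act !big_I3 !uv. Qed.

Lemma lin_actK (M : 'M[algC]_3) v : M \in unitmx -> lin_act (invmx M) (lin_act M v) =1 v.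
Proof. by move=> Mu i; rewrite lin_act_comp mulVmx // lin_act1. Qed.

Lemma lin_actVK (M : 'M[algC]_3) v : M \in unitmx -> lin_act M (lin_act (invmx M) v) =1 v.
Proof. by move=> Mu i; rewrite lin_act_comp mulmxV // lin_act1. Qed.

Lemma lin_actZ (M : 'M[algC]_3) l v :
  lin_act M (fun i => l * v i) =1 (fun i => l * lin_act M v i).
Proof. by move=> i; rewrite /lin_act !big_I3; ring. Qed.

Lemma lin_actD (M : 'M[algC]_3) u v :
  lin_act M (fun i => u i + v i) =1 (fun i => lin_act M u i + lin_act M v i).
Proof. by move=> i; rewrite /lin_act !big_I3; ring. Qed.

Lemma nonzero_lin_act (M : 'M[algC]_3) v :
  M \in unitmx -> nonzero_pt v -> nonzero_pt (lin_act M v).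
Proof.
move=> Mu [i vi]; case: (pickP (fun j => lin_act M v j != 0)) => [j|v0]; first by exists j.
case/eqP: vi; rewrite -(lin_actK v Mu) {1}/lin_act big1 // => j _.
by move/negbFE/eqP: (v0 j) => ->; rewrite mulr0.
Qed.

Lemma apply_map_eq F u v : u =1 v -> apply_map F u =1 apply_map F v.
Proof. by move=> uv i; apply: meval_eq. Qed.

(* A priori the factor relating the two sides of a conjugacy depends on the
   point; comparing the third coordinates, which are quadratic, shows that it
   is constant because it never vanishes. *)
Lemma conjugate_factor a b c d a' b' c' d' (M : 'M[algC]_3) :
  M \in unitmx ->
  (forall v, nonzero_pt v ->
     proj_eq (apply_map (fabcd a b c d) (lin_act M v))
             (lin_act M (apply_map (fabcd a' b' c' d') v))) ->
  exists2 l : algC, l != 0 & forall v i,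
    apply_map (fabcd a b c d) (lin_act M v) i =
    l * lin_act M (apply_map (fabcd a' b' c' d') v) i.
Proof.
move=> Mu MFG; set F := fabcd a b c d in MFG *; set G := fabcd a' b' c' d' in MFG *.
pose q v := lin_act (invmx M) (apply_map F (lin_act M v)) 2.
have qF i : quadratic_form (fun v => apply_map F (lin_act M v) i).
  by apply: quadratic_form_fabcd => j; apply: linear_form_act.
have [c0 [c1 [c2 [c3 [c4 [c5 qE]]]]]] : quadratic_form q.
  exact: quadratic_form_act.
have qG v : nonzero_pt v -> exists2 l, l != 0 & q v = l * v 2 ^+ 2 /\
    forall i, apply_map F (lin_act M v) i = l * lin_act M (apply_map G v) i.
  move=> /MFG[l [l0 E]]; exists l => //; split=> //.
  by rewrite /q (lin_act_eq _ E) lin_actZ lin_actK // apply_fabcd.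
have nz2 v : v 2 != 0 -> nonzero_pt v by exists 2.
(* On the line [z = 0] the relation [q v = l z^2] makes [q] vanish, so [z] divides [q]. *)
have [c00 c10 c30] : [/\ c0 = 0, c1 = 0 & c3 = 0].
  have Z x y : (x != 0) || (y != 0) -> c0 * x ^+ 2 + c1 * y ^+ 2 + c3 * x * y = 0.
    move=> xy; have [] := qG (pt3 x y 0).
      by case/orP: xy => ?; [exists 0|exists 1].
    by move=> l _ [+ _]; rewrite qE /pt3 /= expr0n !mulr0 !addr0.
  have n1 : (1 : algC) != 0 := oner_neq0 _.
  have := Z 1 0; have := Z 0 1; have := Z 1 1; rewrite n1 !orbT.
  rewrite !expr1n !expr0n /= !(mulr0, mulr1, addr0, add0r).
  move=> /(_ isT) + /(_ isT) E1 /(_ isT) E0.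
  by rewrite E1 E0 !add0r.
have qE' v : q v = v 2 * (c4 * v 0 + c5 * v 1 + c2 * v 2).
  by rewrite qE c00 c10 c30; ring.
(* An affine function without zeros on the plane is constant. *)
have nz x y : c4 * x + c5 * y + c2 != 0.
  have [|l l0 [+ _]] := qG (pt3 x y 1); first by exists 2; rewrite /= oner_eq0.
  by rewrite qE' /pt3 /= expr1n mul1r !mulr1 => ->.
have c40 : c4 = 0.
  apply/eqP/negPn/negP => c40; have := nz (- c2 / c4) 0.
  by rewrite mulr0 addr0 mulrC mulfVK // addNr eqxx.
have c50 : c5 = 0.
  apply/eqP/negPn/negP => c50; have := nz 0 (- c2 / c5).
  by rewrite mulr0 add0r mulrC mulfVK // addNr eqxx.
exists c2; first by have := nz 0 0; rewrite !mulr0 !add0r.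
move=> v i; move: v; apply: quadratic_form_eq => //.
  apply: quadratic_formZ; apply: quadratic_form_act => j.
  by apply: quadratic_form_fabcd => k; apply: linear_form_coord.
move=> v v2; have [l l0 [E ->]] := qG v (nz2 v v2); congr (_ * _).
move: E; rewrite qE' c40 c50 !mul0r !add0r => E.
by apply: (@mulIf _ (v 2 ^+ 2)); rewrite ?expf_neq0 // -E; ring.
Qed.

Definition mpoly_act (M : 'M[algC]_3) (G : {mpoly algC[3]}) : {mpoly algC[3]} :=
  G \mPo [tuple \sum_j M i j *: 'X_j | i < 3].

Lemma meval_act M G v : (mpoly_act M G).@[v] = G.@[lin_act M v].
Proof.
rewrite comp_mpoly_meval; apply: meval_eq => i; rewrite tnth_mktuple /lin_act.
by rewrite raddf_sum; apply: eq_bigr => j _; rewrite /= mevalZ mevalXU.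
Qed.

Lemma homog_act M D (G : {mpoly algC[3]}) : G \is D.-homog -> mpoly_act M G \is D.-homog.
Proof.
move=> hG; rewrite /mpoly_act comp_mpolyEX big_seq; apply: rpred_sum => m mG.
apply: rpredZ; rewrite comp_mpolyX (mdeg_supp hG mG).
have L (i : 'I_3) k : tnth [tuple \sum_j M i j *: 'X_j | i < 3] i ^+ k \is k.-homog.
  rewrite -{2}[k]mul1n; apply: dhomogMn; rewrite tnth_mktuple.
  by apply: rpred_sum => j _; apply: rpredZ; rewrite dhomogX; apply/eqP/mdeg1.
rewrite !big_ord_recl big_ord0 mulr1; apply: dhomogM; first exact: L.
by apply: dhomogM; [rewrite (_ : lift _ _ = 1) | rewrite (_ : lift _ _ = 2)]; 
  rewrite ?L //; apply/val_inj.
Qed.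

(** The curve is pulled back by the inverse of [M]. Critical points are transported through
    [critical_polar], which replaces the chain rule. *)
Lemma conjugate_pcf a b c d a' b' c' d' :
  conjugate (fabcd a b c d) (fabcd a' b' c' d') ->
  pcf (fabcd a' b' c' d') -> pcf (fabcd a b c d).
Proof.
move=> [M [Mu /(conjugate_factor Mu)[l l0 MFG]]] [D [H [H0 [hH crit]]]].
set F := fabcd a b c d in MFG *; set G := fabcd a' b' c' d' in MFG crit.
pose N := invmx M; have Nu : N \in unitmx by rewrite unitmx_inv.
have GE v i : apply_map G v i = l^-1 * lin_act N (apply_map F (lin_act M v)) i.
  by rewrite (lin_act_eq _ (MFG v)) lin_actZ lin_actK // mulKf.
have iterE n w : exists m, iter n (apply_map F) w =1
    (fun i => m * lin_act M (iter n (apply_map G) (lin_act N w)) i).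
  elim: n => [|n [m IH]]; first by exists 1 => i; rewrite mul1r lin_actVK.
  (* The scalar is squared because the map is homogeneous of degree 2. *)
  exists (m ^+ 2 * l) => i; rewrite !iterS (apply_map_eq _ IH).
  rewrite -mulrA -MFG !apply_fabcd; set u := lin_act _ _.
  by move: i; apply: forall_I3; rewrite /fmap /pt3 /=; ring.
exists D, (mpoly_act N H); split; last split; last 1 first.
- move=> w /critical_polar[w0 [u [u0 E]]] n n0; have [m iE] := iterE n w.
  rewrite meval_act (meval_eq _ (lin_act_eq _ iE)).
  rewrite (meval_eq _ (lin_actZ _ _ _)) (meval_homog _ _ hH) (meval_eq _ (lin_actK _ Mu)).
  rewrite crit ?mulr0 //; apply/critical_polar; split; first exact: nonzero_lin_act.
  exists (lin_act N u); split; first exact: nonzero_lin_act.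
  move=> i; rewrite !GE -mulrDr -lin_actD; congr (_ * _); apply: lin_act_eq => j.
  rewrite (apply_map_eq _ (v := fun k => w k + u k)); last first.
    by move=> k; rewrite lin_actD !lin_actVK.
  by rewrite E; congr (_ + _); apply: apply_map_eq => k; rewrite lin_actVK.
- apply: contra_neq H0 => NH0; apply: mpoly3_eq0 hH _ => v.
  by rewrite -(meval_eq _ (lin_actK v Mu)) -/N -meval_act NH0 meval0.
- exact: homog_act.
Qed.

(** * The six maps *)

(* The curve [g = 0] contains the image of the critical locus and is forward
   invariant as soon as [g \o F] is divisible by both the Jacobian and [g]. *)
Lemma pcf_invariant_curve a b c d D (G : {mpoly algC[3]})
    (g p q : algC -> algC -> algC -> algC) :
  G \is D.-homog -> (forall v, G.@[v] = g (v 0) (v 1) (v 2)) ->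
  (exists x y z, g x y z != 0) ->
  (forall x y z,
     let gF := g (x ^+ 2 + ratr a * x * z + ratr b * y * z)
                 (y ^+ 2 + ratr c * x * z + ratr d * y * z) (z ^+ 2) in
     gF = p x y z * (z * ((2 * x + ratr a * z) * (2 * y + ratr d * z)
                      - ratr b * ratr c * z ^+ 2)) /\ gF = q x y z * g x y z) ->
  pcf (fabcd a b c d).
Proof.
move=> hG Gg [x [y [z g0]]] gF; exists D, G.
split; first by apply: contra_neq g0 => G0; have := Gg (pt3 x y z); rewrite G0 meval0.
split=> // v [_ Jv]; case=> // n _.
have step u : G.@[apply_map (fabcd a b c d) u] =
    g (u 0 ^+ 2 + ratr a * u 0 * u 2 + ratr b * u 1 * u 2)
      (u 1 ^+ 2 + ratr c * u 0 * u 2 + ratr d * u 1 * u 2) (u 2 ^+ 2).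
  by rewrite Gg !apply_fabcd.
elim: n => [|n IH]; rewrite iterS step.
  have [-> _] := gF (v 0) (v 1) (v 2); move/eqP: Jv.
  by rewrite critical_fabcdE -mulrA mulf_eq0 pnatr_eq0 /= => /eqP ->; rewrite mulr0.
by set u := iter _ _ _ in IH *; have [_ ->] := gF (u 0) (u 1) (u 2); rewrite -Gg IH mulr0.
Qed.

Lemma homogX i : ('X_i : {mpoly algC[3]}) \is 1.-homog.
Proof. by rewrite dhomogX; apply/eqP/mdeg1. Qed.

Lemma homogXX i j : ('X_i * 'X_j : {mpoly algC[3]}) \is 2.-homog.
Proof. exact: (dhomogM (homogX i) (homogX j)). Qed.

Lemma homogXaX l i j : ('X_i + l *: 'X_j : {mpoly algC[3]}) \is 1.-homog.
Proof. by rewrite rpredD ?rpredZ ?homogX. Qed.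

Lemma homogXXaXX l i j k m :
  ('X_i * 'X_j + l *: ('X_k * 'X_m) : {mpoly algC[3]}) \is 2.-homog.
Proof. by rewrite rpredD ?rpredZ ?homogXX. Qed.

Lemma pcf_list_pcf a b c d : (a, b, c, d) \in pcf_list -> pcf (fabcd a b c d).
Proof.
have r2 : ratr (-2) = -2 :> algC by rewrite rmorphN rmorph_nat.
have r1 : ratr (-1) = -1 :> algC by rewrite rmorphN rmorph1.
have r0 : ratr 0 = 0 :> algC by rewrite rmorph0.
have neq0 (n : nat) (w : algC) : w = n.+1%:R -> w != 0 by move=> ->; rewrite pnatr_eq0.
rewrite !inE => /orP[|/orP[|/orP[|/orP[|/orP[|]]]]] /eqP[-> -> -> ->].
- apply: (pcf_invariant_curve (g := fun x y z => x * y * z)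
    (p := fun x y z => x * y * z / 4) (q := fun x y z => x * y * z)
    (dhomogM (homogXX 0 1) (homogX 2))).
  + by move=> v; rewrite !(mevalM, mevalXU).
  + by exists 1, 1, 1; apply: (neq0 0%N); ring.
  + by move=> x y z; rewrite r0; split; field.
(* The critical point 1 of [y^2 - 2y] goes to -1, then to the fixed point 3. *)
- apply: (pcf_invariant_curve (g := fun x y z => x * z * ((y + z) * (y - 3 * z)))
    (p := fun x y z => x * z * (y - z) * ((y + z) * (y - 3 * z)) / 4)
    (q := fun x y z => x * z * (y - z) ^+ 2)
    (dhomogM (homogXX 0 2) (dhomogM (homogXaX 1 1 2) (homogXaX (-3) 1 2)))).
  + by move=> v; rewrite !(mevalD, mevalZ, mevalM, mevalXU); ring.
  + by exists 1, 4, 1; apply: (neq0 4%N); ring.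
  + by move=> x y z; rewrite r0 r2; split; field.
- apply: (pcf_invariant_curve
    (g := fun x y z => (x + z) * (x - 3 * z) * ((y + z) * (y - 3 * z)) * z)
    (p := fun x y z => (x - z) * (y - z) * z
       * ((x + z) * (x - 3 * z) * ((y + z) * (y - 3 * z))) / 4)
    (q := fun x y z => z * (x - z) ^+ 2 * (y - z) ^+ 2)
    (dhomogM (dhomogM (dhomogM (homogXaX 1 0 2) (homogXaX (-3) 0 2))
                      (dhomogM (homogXaX 1 1 2) (homogXaX (-3) 1 2))) (homogX 2))).
  + by move=> v; rewrite !(mevalD, mevalZ, mevalM, mevalXU); ring.
  + by exists 4, 4, 1; apply: (neq0 24%N); ring.
  + by move=> x y z; rewrite r0 r2; split; field.
(* The line [y = 0] and the conic [y^2 = xz] are exchanged by the map. *)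
- apply: (pcf_invariant_curve (g := fun x y z => x * y * z * (y ^+ 2 - x * z))
    (p := fun x y z => x * y * z * (y ^+ 2 - x * z) * (y ^+ 2 - 2 * x * z) / 4)
    (q := fun x y z => x * y * z * (y ^+ 2 - 2 * x * z))
    (dhomogM (dhomogM (homogXX 0 1) (homogX 2)) (homogXXaXX (-1) 1 1 0 2))).
  + by move=> v; rewrite !(mevalD, mevalZ, mevalM, mevalXU); ring.
  + by exists 1, 2, 1; apply: (neq0 5%N); ring.
  + by move=> x y z; rewrite r0 r1; split; field.
(* The critical line [y = 0] is sent onto the conic [y^2 = 4xz], which is invariant. *)
- apply: (pcf_invariant_curve (g := fun x y z => x * z * (y ^+ 2 - 4 * x * z))
    (p := fun x y z => x * y * z * (y ^+ 2 - 4 * x * z) / 4)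
    (q := fun x y z => x * z * y ^+ 2)
    (dhomogM (homogXX 0 2) (homogXXaXX (-4) 1 1 0 2))).
  + by move=> v; rewrite !(mevalD, mevalZ, mevalM, mevalXU); ring.
  + by exists 1, 3, 1; apply: (neq0 4%N); ring.
  + by move=> x y z; rewrite r0 r2; split; field.
(* The invariant curve is the deltoid of the Chebyshev map of type A2. *)
have hX4 i j k m := dhomogM (homogXX i j) (homogXX k m).
have hD := rpredD (rpredD (rpredD (rpredD (hX4 0 1 0 1) (rpredZ (-4) (hX4 0 0 0 2)))
  (rpredZ (-4) (hX4 1 1 1 2))) (rpredZ 18 (hX4 0 1 2 2))) (rpredZ (-27) (hX4 2 2 2 2)).
pose D x y z : algC := x ^+ 2 * y ^+ 2 - 4 * x ^+ 3 * z - 4 * y ^+ 3 * z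
  + 18 * x * y * z ^+ 2 - 27 * z ^+ 4.
apply: (pcf_invariant_curve (g := fun x y z => z * D x y z)
  (p := fun x y z => z * D x y z * (x * y - z ^+ 2) / 4)
  (q := fun x y z => z * (x * y - z ^+ 2) ^+ 2)
  (dhomogM (homogX 2) hD)).
- by move=> v; rewrite !(mevalD, mevalZ, mevalM, mevalXU) /D; ring.
- by exists 1, 0, (-1); rewrite /D; apply: (neq0 22%N); ring.
- by move=> x y z; rewrite r0 r2 /D; split; field.
Qed.

(** * Rational quadratic polynomials *)

Lemma rat_int_of_coprime (x : rat) (m : int) :
  coprimez m (denq x) -> (denq x %| m)%Z -> x = (numq x)%:~R.
Proof.
rewrite coprimez_sym => cop dv; rewrite -[LHS]divq_num_den.
have : coprimez (denq x) (denq x).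
  by apply: coprimez_dvdr dv cop.
rewrite /coprimez gcdzz => /eqP.
by have := denq_gt0 x; case: (denq x) => // n _ [->]; rewrite divr1.
Qed.

(** The denominator of the [n]-th iterate is exactly [q^(2^n)], so a repetition forces [q = 1]. For
    an integer [k] outside [{0, -1, -2}] the absolute values along the orbit strictly increase. *)
Lemma rat_critical_orbit (k : rat) i j : (i < j)%N ->
  iter i (fun z => z ^+ 2 + k) k = iter j (fun z => z ^+ 2 + k) k ->
  k = 0 \/ k = -1 \/ k = -2%:R.
Proof.
move=> ij E; set f := fun z : rat => z ^+ 2 + k in E.
pose q := denq k; pose m := fix m n := if n is n'.+1 then
  m n' ^+ 2 + numq k * q ^+ (2 ^ n).-1 else numq k.
have q0 : q%:~R != 0 :> rat by rewrite intr_eq0 denq_neq0.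
have mE n : iter n f k * q%:~R ^+ (2 ^ n) = (m n)%:~R.
  elim: n => [|n IH]; first by rewrite /= expr1 numqE.
  have -> : m n.+1 = m n ^+ 2 + numq k * q ^+ (2 ^ n.+1).-1 by [].
  rewrite iterS /f mulrDl rmorphD rmorphM !rmorphXn /= -IH [in X in _ + X = _]expnS mulnC.
  rewrite expnSr exprM -exprMn.
  congr (_ + _); rewrite -exprM -[in LHS](prednK (_ : 0 < 2 ^ n * 2)%N) ?muln_gt0 ?expn_gt0 //.
  by rewrite exprS mulrA numqE.
have cop n : coprimez (m n) q.
  elim: n => [|n IH]; first exact: coprime_num_den.
  have -> : m n.+1 = numq k * q ^+ (2 ^ n.+1).-2 * q + m n ^+ 2.
    rewrite -mulrA -exprSr prednK; first by rewrite addrC.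
    by rewrite expnS; have := expn_gt0 2 n; lia.
  by rewrite coprimez_sym /coprimez gcdzMDl -/(coprimez _ _) coprimezXr // coprimez_sym.
have dv : (q %| m j)%Z.
  have mj : (m j)%:~R = (m i * q ^+ (2 ^ j - 2 ^ i))%:~R :> rat.
    rewrite rmorphM rmorphXn /= -!mE E -mulrA -exprD subnKC //.
    by rewrite leq_exp2l // ltnW.
  have/intr_inj -> := mj.
  by rewrite dvdz_mull // dvdz_exp // subn_gt0 ltn_exp2l.
have kz := rat_int_of_coprime (cop j) dv.
move: (numq k) kz => z kz; clear m mE cop dv q q0.
pose g (x : int) := x ^+ 2 + z.
have gE n : iter n f k = (iter n g z)%:~R.
  by elim: n => //= n ->; rewrite /f /g kz rmorphD rmorphXn.
have {}E : iter i g z = iter j g z by apply: (@intr_inj rat); rewrite -!gE.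
have [|] := boolP ((0 < z) || (z < -2)).
  move=> zz; suff inc n : (`|z| <= `|iter n g z|) && (`|iter n g z| < `|iter n.+1 g z|).
    have : {homo (fun n => `|iter n g z|) : n m / (n < m)%N >-> n < m}.
      by apply: homo_ltn => [y x t|n]; [apply: lt_trans|case/andP: (inc n)].
    by move=> /(_ i j ij); rewrite E ltxx.
  elim: n => [|n /andP[IH1 IH2]]; [rewrite lexx /=|rewrite (le_trans IH1 (ltW IH2)) andTb].
    rewrite /g; move: zz; nia.
  rewrite [iter n.+2 g z]iterS; move: (iter n.+1 g z) (iter n g z) IH1 IH2 => x y h1 h2.
  have : `|z| < `|x| by lia.
  rewrite /g; move: zz; nia.
move=> H; have : z = 0 \/ z = -1 \/ z = -2 by lia.
by rewrite kz; move=> [->|[->|->]]; [left|right; left|right; right].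
Qed.

Lemma rat_sqr_int (x : rat) (n : int) : x ^+ 2 = n%:~R -> x = (numq x)%:~R.
Proof.
move=> xn; apply: (@rat_int_of_coprime _ (numq x ^+ 2)).
  by rewrite coprimezXl //; apply: coprime_num_den.
have -> : numq x ^+ 2 = n * denq x ^+ 2.
  by apply: (@intr_inj rat); rewrite [RHS]rmorphM !rmorphXn /= numqE exprMn xn.
by rewrite dvdz_mull // dvdz_exp.
Qed.

(** * Reduction to the list *)

Section Translation.
Variables a b c d p q : rat.
Hypotheses (fixp : p ^+ 2 + a * p + b * q = p) (fixq : q ^+ 2 + c * p + d * q = q).

Let fixp' : (ratr p : algC) = ratr p ^+ 2 + ratr a * ratr p + ratr b * ratr q.
Proof. by rewrite -{1}fixp !rmorphD rmorphXn !rmorphM. Qed.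
Let fixq' : (ratr q : algC) = ratr q ^+ 2 + ratr c * ratr p + ratr d * ratr q.
Proof. by rewrite -{1}fixq !rmorphD rmorphXn !rmorphM. Qed.

Let ratrD2 (x y : rat) : ratr (x + 2 * y) = ratr x + 2 * ratr y :> algC.
Proof. by rewrite rmorphD rmorphM rmorph_nat. Qed.

(** Moving the fixed point [(p, q)] to the origin produces no constant term and changes only the
    diagonal of the linear part. *)
Lemma conjugate_translate :
  conjugate (fabcd a b c d) (fabcd (a + 2 * p) b c (d + 2 * q)).
Proof.
pose M : 'M[algC]_3 := \matrix_(i, j)
  pt3 (pt3 1 0 (ratr p)) (pt3 0 1 (ratr q)) (pt3 0 0 1) i j.
exists M; split.
  by rewrite unitmxE det3 !mxE /pt3 /= (_ : _ + _ = 1) ?unitr1 //; ring.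
move=> v _; exists 1; split; first exact: oner_neq0.
have ME u : lin_act M u =1 pt3 (u 0 + ratr p * u 2) (u 1 + ratr q * u 2) (u 2).
  by apply: forall_I3; rewrite /lin_act big_I3 !mxE /pt3 /=; ring.
move=> i; rewrite mul1r (apply_map_eq _ (ME v)) ME; move: i.
apply: forall_I3; rewrite /pt3 !apply_fabcd /fmap /pt3 /= ?ratrD2.
- by rewrite [X in _ = _ + X * _]fixp'; ring.
- by rewrite [X in _ = _ + X * _]fixq'; ring.
- by [].
Qed.

Lemma conjugate_translate_swap :
  conjugate (fabcd a b c d) (fabcd (d + 2 * q) c b (a + 2 * p)).
Proof.
pose M : 'M[algC]_3 := \matrix_(i, j)
  pt3 (pt3 0 1 (ratr p)) (pt3 1 0 (ratr q)) (pt3 0 0 1) i j.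
exists M; split.
  by rewrite unitmxE det3 !mxE /pt3 /= (_ : _ + _ = -1) ?unitrN ?unitr1 //; ring.
move=> v _; exists 1; split; first exact: oner_neq0.
have ME u : lin_act M u =1 pt3 (u 1 + ratr p * u 2) (u 0 + ratr q * u 2) (u 2).
  by apply: forall_I3; rewrite /lin_act big_I3 !mxE /pt3 /=; ring.
move=> i; rewrite mul1r (apply_map_eq _ (ME v)) ME; move: i.
apply: forall_I3; rewrite /pt3 !apply_fabcd /fmap /pt3 /= ?ratrD2.
- by rewrite [X in _ = _ + X * _]fixp'; ring.
- by rewrite [X in _ = _ + X * _]fixq'; ring.
- by [].
Qed.
End Translation.

Lemma pcf_swap a b c d : pcf (fabcd a b c d) -> pcf (fabcd d c b a).
Proof.
apply: conjugate_pcf; have := @conjugate_translate_swap d c b a 0 0.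
by rewrite !mulr0 !addr0; apply; rewrite expr0n.
Qed.

Lemma ratr_iter (k : rat) n :
  iter n (fun z => z ^+ 2 + ratr k) (ratr k) =
  ratr (iter n (fun z => z ^+ 2 + k) k) :> algC.
Proof. by elim: n => //= n ->; rewrite rmorphD rmorphXn. Qed.

Lemma ratr_critical_orbit (k : rat) :
  (exists i j, (i < j)%N /\ iter i (fun z => z ^+ 2 + ratr k) (ratr k) =
     iter j (fun z => z ^+ 2 + ratr k) (ratr k) :> algC) ->
  k = 0 \/ k = -1 \/ k = -2%:R.
Proof.
move=> [i [j [ij]]]; rewrite !ratr_iter => /fmorph_inj; exact: rat_critical_orbit.
Qed.

(** 5 and 17 are the values that [(d - 1)^2] or [(a - 1)^2] would take in the cases to be
    excluded. *)
Lemma rat_not_sqr (x : rat) (n : nat) : (n == 5%N) || (n == 17%N) -> x ^+ 2 <> n%:R.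
Proof.
move=> n5 E; have xz := @rat_sqr_int x n E.
move: E; rewrite xz => E; have {}E : numq x ^+ 2 = n by apply: (@intr_inj rat); rewrite rmorphXn.
have : (`|numq x| ^ 2 = n)%N by rewrite -abszX E.
by case/orP: n5 => /eqP ->; move: `|numq x|%N => [|[|[|[|[|m]]]]] //; nia.
Qed.

Lemma quadratic_roots (K : idomainType) (x r s : K) :
  (x - r) * (x - s) = 0 -> x = r \/ x = s.
Proof. by move/eqP; rewrite mulf_eq0 !subr_eq0 => /orP[]/eqP; [left|right]. Qed.

(* Constraints coming from the branch of the critical conic at [1:0:0]; the
   other branch gives the same ones with the coordinates exchanged. *)
Lemma pcf_end a b c d : pcf (fabcd a b c d) ->
  [\/ c = 0 /\ [\/ d = 0, d = 2, d = 4 | d = -2],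
      [/\ c = -1, b = 0, a = 0 & d = 0 \/ d = 2] |
      c = -2 /\ 4 * a = d ^+ 2 - 2 * d].
Proof.
move=> /pcf_trapped tr; have := trapped_critical_orbit tr.
have half (x : rat) : ratr x / 2 = ratr (x / 2) :> algC by rewrite fmorph_div rmorph_nat.
case/ratr_critical_orbit => [c0|[c1|c2]].
(* Here [d/2 - (d/2)^2] must be 0, -1 or -2; the value -1 would make 5 a rational square. *)
- constructor 1; split=> //; move: tr; rewrite c0 rmorph0 mulr0 mul0r => /trapped_line /=.
  have -> : ratr d / 2 - (ratr d / 2) ^+ 2 = ratr (d / 2 - (d / 2) ^+ 2) :> algC.
    by rewrite half rmorphB rmorphXn.
  case/ratr_critical_orbit => [E|[E|E]].
  + have /eqP : d * (d - 2) = 0 by lra.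
    rewrite mulf_eq0 subr_eq0 => /orP[]/eqP; by [constructor 1|constructor 2].
  + by case: (@rat_not_sqr (d - 1) 5 isT); lra.
  + have /eqP : (d - 4) * (d + 2) = 0 by lra.
    rewrite mulf_eq0 subr_eq0 addr_eq0 => /orP[]/eqP; by [constructor 3|constructor 4].
- constructor 2; have c1' : ratr c = -1 :> algC by rewrite c1 rmorphN rmorph1.
  have [|/eqP + aE] := trapped_c1 tr c1'; first by field.
  rewrite fmorph_eq0 => /eqP b0.
  have {}aE : (a / 2) ^+ 2 = a / 2 by apply: (fmorph_inj (ratr : {rmorphism rat -> algC})); rewrite rmorphXn /= -half.
  have adE : a / 2 = (d / 2) ^+ 2 - d / 2.
    apply: (fmorph_inj (ratr : {rmorphism rat -> algC})); rewrite rmorphB rmorphXn /= -!half.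
    exact: trapped_c1_deriv tr c1'.
  have /eqP : a * (a - 2) = 0 by lra.
  rewrite mulf_eq0 subr_eq0 => /orP[]/eqP a0.
    split=> //; have /eqP : d * (d - 2) = 0 by rewrite a0 in adE; lra.
    by rewrite mulf_eq0 subr_eq0 => /orP[]/eqP; [left|right].
  by case: (@rat_not_sqr (d - 1) 5 isT); rewrite a0 in adE; lra.
- constructor 3; split=> //; have c2' : ratr c = -2 :> algC by rewrite c2 rmorphN rmorph_nat.
  suff : 2 * (a / 2) = (d / 2) ^+ 2 - d / 2 by lra.
  apply: (fmorph_inj (ratr : {rmorphism rat -> algC})).
  rewrite rmorphB rmorphM rmorphXn rmorph_nat /= -!half.
  exact: trapped_c2 tr c2'.
Qed.

Definition listed_or_conjugate a b c d :=
  exists a' b' c' d' : rat, (a', b', c', d') \in pcf_list /\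
     conjugate (fabcd a b c d) (fabcd a' b' c' d').

(** The target coefficients determine the fixed point, since a translation turns [a] into [a + 2p]
    and [d] into [d + 2q]. *)
Lemma conjugate_by_translation a b c d a' d' :
  let p := (a' - a) / 2 in let q := (d' - d) / 2 in
  p ^+ 2 + a * p + b * q = p -> q ^+ 2 + c * p + d * q = q ->
  ((a', b, c, d') \in pcf_list) || ((d', c, b, a') \in pcf_list) ->
  listed_or_conjugate a b c d.
Proof.
move=> p q fp fq; have aE : a' = a + 2 * p by rewrite /p; field.
have dE : d' = d + 2 * q by rewrite /q; field.
case/orP=> H; [exists a', b, c, d'|exists d', c, b, a']; split=> //; rewrite aE dE.
  exact: conjugate_translate.
exact: conjugate_translate_swap.
Qed.

Lemma pcf_listed_or_conjugate a b c d :
  pcf (fabcd a b c d) -> listed_or_conjugate a b c d.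
Proof.
move=> H; have := pcf_end H; have := pcf_end (pcf_swap H) => {H}.
pose T := @conjugate_by_translation a b c d.
have fin a' d' : 
  let p := (a' - a) / 2 in let q := (d' - d) / 2 in
  (p ^+ 2 + a * p + b * q == p) && (q ^+ 2 + c * p + d * q == q) &&
  (((a', b, c, d') \in pcf_list) || ((d', c, b, a') \in pcf_list)) ->
  listed_or_conjugate a b c d.
  by move=> p q /andP[/andP[/eqP fp /eqP fq]]; apply: T.
case=> [[b0 aE]|[b1 c0 d0 aE]|[b2 dE]]; case=> [[c0' dE']|[c1 b0' a0 dE']|[c2 aE']];
  try (by exfalso; lra).
(* For [b = c = 0] the coordinates separate: coefficients 0 and 2 reduce to 0, while 4 and -2 reduce
   to -2. *)
- have {}aE : exists a', (a' = 0 \/ a' = -2) /\ ((a' - a) / 2) ^+ 2 + a * ((a' - a) / 2) = (a' - a) / 2.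
    by case: aE => ->; [exists 0|exists 0|exists (-2)|exists (-2)]; split; lra.
  have {}dE' : exists a', (a' = 0 \/ a' = -2) /\ ((a' - d) / 2) ^+ 2 + d * ((a' - d) / 2) = (a' - d) / 2.
    by case: dE' => ->; [exists 0|exists 0|exists (-2)|exists (-2)]; split; lra.
  case: aE => a' [Ha Ea]; case: dE' => d' [Hd Ed]; apply: (T a' d').
  + by rewrite b0 mul0r addr0.
  + by rewrite c0' mul0r addr0.
  + by rewrite b0 c0'; case: Ha => ->; case: Hd => ->.
- apply: (fin 0 0); subst; by case: dE' => ->.
- have dE : (a, d) \in [:: (0, 0); (0, 2); (2, 4); (2, -2)].
    case: aE aE' => -> E.
    + by case: (@quadratic_roots _ d 0 2) => [|-> //|-> //]; lra.
    + by case: (@quadratic_roots _ d 4 (-2)) => [|-> //|-> //]; lra.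
    + by case: (@rat_not_sqr (d - 1) 17 isT); lra.
    + by exfalso; nra.
  apply: (fin 0 0); rewrite b0 c2; move: dE; rewrite !inE.
  by case/orP=> [|/orP[|/orP[]]] /eqP[-> ->].
- by apply: (fin 0 0); rewrite b1 c0 d0; case: aE => ->.
- have aE : (a, d) \in [:: (0, 0); (2, 0); (4, 2); (-2, 2)].
    case: dE' dE => -> E.
    + by case: (@quadratic_roots _ a 0 2) => [|-> //|-> //]; lra.
    + by case: (@quadratic_roots _ a 4 (-2)) => [|-> //|-> //]; lra.
    + by case: (@rat_not_sqr (a - 1) 17 isT); lra.
    + by exfalso; nra.
  apply: (fin 0 0); rewrite b2 c0'; move: aE; rewrite !inE.
  by case/orP=> [|/orP[|/orP[]]] /eqP[-> ->].
(* For [b = c = -2] the difference of the two relations factors; [a + d + 2 = 0] would give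
   [a^2 + 2a + 8 = 0], which has no real root. *)
have /eqP : (a - d) * (a + d + 2) = 0 by lra.
rewrite mulf_eq0 => /orP[]/eqP ad; last by exfalso; nra.
have da : d = a by lra.
apply: (fin 0 0); rewrite b2 c2 da.
by case: (@quadratic_roots _ a 0 6) => [|-> //|-> //]; first by (rewrite da in dE; lra).
Qed.

Theorem theorem1p4 (a b c d : rat) :
  pcf (fabcd a b c d) <->
  ((a, b, c, d) \in pcf_list \/
   exists a' b' c' d' : rat, (a', b', c', d') \in pcf_list /\
     conjugate (fabcd a b c d) (fabcd a' b' c' d')).
Proof.
split=> [/pcf_listed_or_conjugate|]; first by right.
case=> [/pcf_list_pcf //|[a' [b' [c' [d' [/pcf_list_pcf H]]]]]].
by move=> /conjugate_pcf; apply.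
Qed.
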